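(* Assume that the pilot sensing matrix $\boldsymbol{\Psi}_p\in\mathbb{C}^{N\times QL}$ has full column rank, and consider the matched-pilot estimator $\hat{\boldsymbol{\gamma}}=\mathbf{R}_{pp}^{-1}\mathbf{t}_p$, where $\mathbf{R}_{pp}=\boldsymbol{\Psi}_p^H\boldsymbol{\Psi}_p$ and $\mathbf{t}_p=\boldsymbol{\Psi}_p^H\mathbf{r}$, with $\mathbf{r}=\boldsymbol{\Psi}_p\boldsymbol{\gamma}+\boldsymbol{\Psi}_u(\mathbf{s}_u)\boldsymbol{\gamma}+\mathbf{w}$. (i) In the noiseless model ($\mathbf{w}=\mathbf{0}$), one has $\hat{\boldsymbol{\gamma}}=\boldsymbol{\gamma}$ for every admissible payload vector $\mathbf{s}_u\in\mathcal{A}^{N_u}$ and every coefficient vector $\boldsymbol{\gamma}\in\mathbb{C}^{QL}$ if and only if the zero pilot--data interference (ZPDI) condition $$\mathbf{R}_{pu}(\mathbf{s}_u)=\boldsymbol{\Psi}_p^H\boldsymbol{\Psi}_u(\mathbf{s}_u)=\mathbf{0}\quad\text{for every admissible payload vector }\mathbf{s}_u\in\mathcal{A}^{N_u}$$ holds. (ii) Under the ZPDI condition, the estimator $$\hat{\boldsymbol{\gamma}}=\mathbf{R}_{pp}^{-1}\mathbf{t}_p=\left(\boldsymbol{\Psi}_p^H\boldsymbol{\Psi}_p\right)^{-1}\boldsymbol{\Psi}_p^H\mathbf{r},$$ which depends only on $\boldsymbol{\Psi}_p$ and $\mathbf{r}$, coincides with the maximum-likelihood estimator of $\boldsymbol{\gamma}$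 based on the reduced observation $\mathbf{t}_p=\mathbf{R}_{pp}\boldsymbol{\gamma}+\mathbf{R}_{pu}(\mathbf{s}_u)\boldsymbol{\gamma}+\widetilde{\mathbf{w}}_p$ with Gaussian noise $\widetilde{\mathbf{w}}_p\sim\mathcal{CN}(\mathbf{0},\sigma_w^2\mathbf{R}_{pp})$.
   Context: Let $N,L,Q,N_p,N_u$ be positive integers and $N_s=N_p+N_u$. Pilot symbols $\mathbf{s}_p\in\mathbb{C}^{N_p}$ are known and fixed; payload symbols $\mathbf{s}_u$ range over the admissible set $\mathcal{A}^{N_u}$, where $\mathcal{A}\subset\mathbb{C}$ is the symbol alphabet. Binary selection matrices $\mathbf{P}_p\in\{0,1\}^{N_s\times N_p}$ and $\mathbf{P}_u\in\{0,1\}^{N_s\times N_u}$ place pilots and payload at disjoint positions ($\mathbf{P}_p^T\mathbf{P}_u=\mathbf{0}$) of the symbol vector $\mathbf{s}=\mathbf{P}_p\mathbf{s}_p+\mathbf{P}_u\mathbf{s}_u$. A coding matrix $\mathbf{C}\in\mathbb{C}^{N\times N_s}$ produces the transmitted block $\mathbf{x}=\mathbf{C}\mathbf{s}=\mathbf{x}_p+\mathbf{x}_u$, with $\mathbf{x}_p=\mathbf{C}\mathbf{P}_p\mathbf{s}_p$ and $\mathbf{x}_u=\mathbf{C}\mathbf{P}_u\mathbf{s}_u$. For $\ell=0,\ldots,L-1$, $\mathbf{S}_\ell\in\mathbb{C}^{N\times N}$ is a guard-dependent shift operator, given by one of the following three modes (the same for all $\ell$), with indices in $\{0,\ldots,N-1\}$: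 cyclic prefix, $\mathbf{S}_\ell=\boldsymbol{\Pi}^\ell$ with $\boldsymbol{\Pi}$ the $N\times N$ cyclic permutation matrix, $(\boldsymbol{\Pi}\mathbf{x})[n]=\mathbf{x}[(n-1)\bmod N]$; zero padding, $[\mathbf{S}_\ell]_{n,k}=1$ if $n=k+\ell$ and $0$ otherwise; chirp periodic prefix, $\mathbf{S}_\ell=\boldsymbol{\Omega}_\ell\boldsymbol{\Pi}^\ell$ with $\boldsymbol{\Omega}_\ell=\mathrm{diag}(\omega_\ell[k])_{k=0}^{N-1}$, $\omega_\ell[k]=e^{j2\pi c_1(\ell^2-2\ell k)/N}$ for $k=0,\ldots,\ell-1$ and $\omega_\ell[k]=1$ otherwise ($c_1$ a real parameter). For a vector $\mathbf{x}\in\mathbb{C}^N$ put $\mathbf{Z}(\mathbf{x})=[\mathrm{diag}(\mathbf{S}_0\mathbf{x}),\ldots,\mathrm{diag}(\mathbf{S}_{L-1}\mathbf{x})]\in\mathbb{C}^{N\times NL}$. Let $\boldsymbol{\Phi}\in\mathbb{C}^{N\times Q}$ be the basis matrix of the basis expansion model (BEM), $\mathbf{B}=\mathbf{I}_L\otimes\boldsymbol{\Phi}\in\mathbb{C}^{NL\times QL}$, and let $\mathbf{D}\in\mathbb{C}^{N\times N}$ be unitary. The pilot and payload sensing matrices are $\boldsymbol{\Psi}_p=\mathbf{D}\mathbf{Z}(\mathbf{x}_p)\mathbf{B}$ and $\boldsymbol{\Psi}_u(\mathbf{s}_u)=\mathbf{D}\mathbf{Z}(\mathbf{x}_u)\mathbf{B}$,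 both in $\mathbb{C}^{N\times QL}$. The observation model, within the selected BEM subspace (no modeling error), is $\mathbf{r}=\boldsymbol{\Psi}_p\boldsymbol{\gamma}+\boldsymbol{\Psi}_u(\mathbf{s}_u)\boldsymbol{\gamma}+\mathbf{w}$ with $\boldsymbol{\gamma}\in\mathbb{C}^{QL}$ the unknown deterministic BEM coefficient vector and $\mathbf{w}\sim\mathcal{CN}(\mathbf{0},\sigma_w^2\mathbf{I})$, $\sigma_w^2>0$. Define $\mathbf{R}_{pp}=\boldsymbol{\Psi}_p^H\boldsymbol{\Psi}_p$, $\mathbf{R}_{pu}(\mathbf{s}_u)=\boldsymbol{\Psi}_p^H\boldsymbol{\Psi}_u(\mathbf{s}_u)$, $\mathbf{t}_p=\boldsymbol{\Psi}_p^H\mathbf{r}$, $\widetilde{\mathbf{w}}_p=\boldsymbol{\Psi}_p^H\mathbf{w}\sim\mathcal{CN}(\mathbf{0},\sigma_w^2\mathbf{R}_{pp})$. Here $\mathcal{CN}(\boldsymbol{\mu},\mathbf{K})$ is the circularly symmetric complex Gaussian law. The maximum-likelihood estimator based on $\mathbf{t}_p$ is the maximizer over $\boldsymbol{\gamma}\in\mathbb{C}^{QL}$ of the density of $\mathbf{t}_p$ evaluated at the observed value. *)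

(* Defs.v *)
From HB Require Import structures.
From mathcomp Require Import all_boot all_order all_algebra.
From mathcomp Require Import classical_sets reals sequences exp trigo.
From mathcomp Require Import complex.
From mathcomp Require mxtens.

Set Implicit Arguments.
Unset Strict Implicit.
Unset Printing Implicit Defensive.

Import Order.TTheory GRing.Theory Num.Theory.

Local Open Scope ring_scope.
Local Open Scope complex_scope.
Local Open Scope sesquilinear_scope.

Definition expj (R : realType) (theta : R) : R[i] := cos theta +i* sin theta.

Definition binary_mx (R : realType) m n (P : 'M[R[i]]_(m, n)) : Prop :=
  forall i j, P i j = 0 \/ P i j = 1.

Definition admissible (R : realType) (A : set R[i]) n (s : 'cV[R[i]]_n) : Prop :=
  forall i, A (s i 0).

Inductive guard := CyclicPrefix | ZeroPadding | ChirpPeriodicPrefix.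

(* [ord_pred n] is n - 1 modulo N, so that (cyclic_mx *m x) n = x (n - 1). *)
Definition cyclic_mx (R : realType) N : 'M[R[i]]_N :=
  \matrix_(n, k) (k == ord_pred n)%:R.

Definition chirp_phase (R : realType) N (c1 : R) (l k : nat) : R[i] :=
  if (k < l)%N then
    expj (2 * pi * c1 * (l%:R ^+ 2 - 2 * l%:R * k%:R) / N%:R)
  else 1.

Definition shift_mx (R : realType) N (g : guard) (c1 : R) (l : nat) :
    'M[R[i]]_N :=
  match g with
  | CyclicPrefix => cyclic_mx R N ^+ l
  | ZeroPadding => \matrix_(n, k) ((n : nat) == (k + l)%N)%:R
  | ChirpPeriodicPrefix =>
      diag_mx (\row_k chirp_phase N c1 l k) *m (cyclic_mx R N ^+ l)
  end.

(* Horizontal concatenation of the L blocks diag (S_l x); column l * N + k,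
   which [mxtens_unindex] decomposes as (l, k), is column k of block l. This is
   the index convention of the Kronecker product [tensmx] below. *)
Definition delay_mx (R : realType) N L (g : guard) (c1 : R) (x : 'cV[R[i]]_N) :
    'M[R[i]]_(N, L * N) :=
  \matrix_(n, j)
    diag_mx (shift_mx N g c1 (mxtens.mxtens_unindex j).1 *m x)^T
      n (mxtens.mxtens_unindex j).2.

Definition bem_mx (R : realType) N L Q (Phi : 'M[R[i]]_(N, Q)) :
    'M[R[i]]_(L * N, L * Q) :=
  mxtens.tensmx (1%:M : 'M[R[i]]_L) Phi.

Definition sensing_mx (R : realType) N L Q (g : guard) (c1 : R)
    (Phi : 'M[R[i]]_(N, Q)) (D : 'M[R[i]]_N) (x : 'cV[R[i]]_N) :
    'M[R[i]]_(N, L * Q) :=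
  D *m delay_mx L g c1 x *m bem_mx L Phi.

Definition observation (R : realType) N M (Psi_p Psi_u : 'M[R[i]]_(N, M))
    (gamma : 'cV[R[i]]_M) (w : 'cV[R[i]]_N) : 'cV[R[i]]_N :=
  Psi_p *m gamma + Psi_u *m gamma + w.

Definition matched_pilot (R : realType) N M (Psi_p : 'M[R[i]]_(N, M))
    (r : 'cV[R[i]]_N) : 'cV[R[i]]_M :=
  Psi_p^t* *m r.

Definition matched_estimator (R : realType) N M (Psi_p : 'M[R[i]]_(N, M))
    (r : 'cV[R[i]]_N) : 'cV[R[i]]_M :=
  invmx (Psi_p^t* *m Psi_p) *m matched_pilot Psi_p r.

Definition zpdi (R : realType) N M n (A : set R[i]) (Psi_p : 'M[R[i]]_(N, M))
    (Psi_u : 'cV[R[i]]_n -> 'M[R[i]]_(N, M)) : Prop :=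
  forall s_u, admissible A s_u -> Psi_p^t* *m Psi_u s_u = 0.

(* Density, with respect to Lebesgue measure on C^n = R^(2n), of the circularly
   symmetric complex Gaussian law CN(mu, K) with K Hermitian positive definite:
     z |-> exp (- (z - mu)^H K^-1 (z - mu)) / (pi^n det K).
   For such K both real parts are taken of real numbers. *)
Definition cn_pdf (R : realType) n (mu : 'cV[R[i]]_n) (K : 'M[R[i]]_n)
    (z : 'cV[R[i]]_n) : R :=
  expR (- complex.Re (((z - mu)^t* *m invmx K *m (z - mu)) 0 0))
    / (pi ^+ n * complex.Re (\det K)).

(* Density at t of R_pp gamma + R_pu gamma + w~ where w~ has law
   CN(0, sigma2 R_pp). *)
Definition reduced_likelihood (R : realType) N M (sigma2 : R)
    (Psi_p Psi_u : 'M[R[i]]_(N, M)) (t gamma : 'cV[R[i]]_M) : R :=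
  let R_pp := Psi_p^t* *m Psi_p in
  let R_pu := Psi_p^t* *m Psi_u in
  cn_pdf (R_pp *m gamma + R_pu *m gamma) (sigma2%:C *: R_pp) t.

Definition is_maximizer (R : realType) (T : Type) (f : T -> R) (x : T) : Prop :=
  forall y, f y <= f x.

Lemma matched_pilot_observation (R : realType) N M
    (Psi_p Psi_u : 'M[R[i]]_(N, M)) (gamma : 'cV[R[i]]_M) (w : 'cV[R[i]]_N) :
  matched_pilot Psi_p (observation Psi_p Psi_u gamma w) =
  (Psi_p^t* *m Psi_p) *m gamma + (Psi_p^t* *m Psi_u) *m gamma + Psi_p^t* *m w.
Proof. by rewrite /matched_pilot /observation !mulmxDr !mulmxA. Qed.

(* Main.v *)
(* Without noise, gammahat = gamma + R_pp^-1 R_pu gamma, so exact recovery of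
   every gamma means R_pu = 0. With R_pu = 0 the reduced likelihood of gamma is
   the density at t_p of CN(R_pp gamma, sigma2 R_pp); the covariance being
   positive definite, a Gaussian density at a given point is largest exactly
   when its mean is that point, i.e. when R_pp gamma = t_p. *)

Require Import Defs.
From mathcomp Require Import all_boot all_order all_algebra.
From mathcomp Require Import classical_sets reals sequences exp trigo.
From mathcomp Require Import complex.

Import Order.TTheory GRing.Theory Num.Theory.
Local Open Scope ring_scope.
Local Open Scope complex_scope.
Local Open Scope sesquilinear_scope.

(** The order of [F] is partial, so [0 <] also says that the value of the form is real. *)
Definition posdefmx {F : numClosedFieldType} {n} (K : 'M[F]_n) : Prop :=
  K^t* = K /\ forall v : 'cV[F]_n, v != 0 -> 0 < (v^t* *m K *m v) 0 0.

Lemma adjmxM {F : numClosedFieldType} {m n p}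
    (A : 'M[F]_(m, n)) (B : 'M_(n, p)) :
  (A *m B)^t* = B^t* *m A^t*.
Proof. by rewrite trmx_mul map_mxM. Qed.

Lemma normsq_cV_gt0 {F : numClosedFieldType} {n} (v : 'cV[F]_n) :
  v != 0 -> 0 < (v^t* *m v) 0 0.
Proof.
move=> v0; have E : (v^t* *m v) 0 0 = \sum_i `|v i 0| ^+ 2.
  by rewrite mxE; apply: eq_bigr => i _; rewrite !mxE normCKC.
rewrite E lt_def sumr_ge0 ?andbT => [|i _]; last exact: exprn_ge0.
apply: contraNneq v0 => /psumr_eq0P v0; apply/eqP/colP => i; rewrite mxE.
by apply/eqP; rewrite -normr_eq0 -sqrf_eq0 v0 // => j _; apply: exprn_ge0.
Qed.

(** The form at [v] is the squared norm of [A *m v], and full column rank makes [A] injective on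
    columns. *)
Lemma posdefmx_gram {F : numClosedFieldType} {m n} (A : 'M[F]_(m, n)) :
  \rank A = n -> posdefmx (A^t* *m A).
Proof.
move=> rkA; split; first by rewrite adjmxM trmxCK.
move=> v v0; rewrite mulmxA -adjmxM -mulmxA; apply: normsq_cV_gt0.
have freeA : row_free A^T by rewrite /row_free mxrank_tr rkA.
apply: contraNneq v0 => Av0; rewrite -trmx_eq0 -(mulmx_free_eq0 _ freeA).
by rewrite -trmx_mul Av0 trmx0.
Qed.

Lemma posdefmxZ {F : numClosedFieldType} {n} (c : F) (K : 'M[F]_n) :
  0 < c -> posdefmx K -> posdefmx (c *: K).
Proof.
move=> c0 [Kh Kp]; split.
  by rewrite linearZ /= map_mxZ Kh; congr (_ *: _); exact/conj_Creal/gtr0_real.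
by move=> v v0; rewrite -scalemxAr -scalemxAl mxE mulr_gt0 ?Kp.
Qed.

Lemma posdefmx_unit {F : numClosedFieldType} {n} (K : 'M[F]_n) :
  posdefmx K -> K \in unitmx.
Proof.
move=> [_ Kp]; rewrite -unitmx_tr -row_free_unit -kermx_eq0.
apply/rowV0P => u /sub_kermxP uK; apply: contraTeq isT => u0.
(* [kermx] is a left kernel, so the row [u] is transposed into a column on which the form of [K]
   would vanish. *)
have Ku : K *m u^T = 0 by rewrite -[K]trmxK -trmx_mul uK trmx0.
have := Kp u^T; rewrite trmx_eq0 => /(_ u0).
by rewrite -mulmxA Ku mulmx0 mxE ltxx.
Qed.

(** The form of [invmx K] at [v] is the form of [K] at [invmx K *m v]. *)
Lemma posdefmx_inv {F : numClosedFieldType} {n} (K : 'M[F]_n) :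
  posdefmx K -> posdefmx (invmx K).
Proof.
move=> Kpd; have Ku := posdefmx_unit _ Kpd; case: Kpd => Kh Kp.
have Kih : (invmx K)^t* = invmx K by rewrite trmx_inv map_invmx Kh.
split=> // v v0; have {1}-> : v^t* = (invmx K *m v)^t* *m K.
  by rewrite adjmxM Kih mulmxKV.
rewrite -mulmxA; apply: Kp; apply: contraNneq v0 => Kv0.
by rewrite -(mulKVmx Ku v) Kv0 mulmx0.
Qed.

(* By the spectral theorem the determinant is the product of the eigenvalues. *)
Lemma det_posdefmx_gt0 {F : numClosedFieldType} {n} (K : 'M[F]_n) :
  posdefmx K -> 0 < \det K.
Proof.
case=> Kh Kp; set P := spectralmx K; set d := spectral_diag K.
have Pu : P \is unitarymx := spectral_unitarymx K.
have PU := unitarymx_unit Pu.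
have KE : K = invmx P *m diag_mx d *m P.
  by apply/orthomx_spectralP/normalmxP; rewrite Kh.
rewrite KE !det_mulmx det_inv mulrAC mulVr -?unitmxE // mul1r det_diag.
apply: prodr_gt0 => i _.
have PK : P *m K *m P^t* = diag_mx d.
  by rewrite KE -invmx_unitary // !mulmxA mulmxV // mul1mx mulmxK.
(* The adjoint of row [i] of [P] is an eigenvector, so the eigenvalue is a value of the form; it is
   nonzero because [P] is invertible. *)
have dE : d 0 i = ((row i P)^t*^t* *m K *m (row i P)^t*) 0 0.
  have := congr1 (fun M : 'M_n => M i i) PK; rewrite [RHS]mxE eqxx mulr1n => <-.
  rewrite trmxCK -row_mul tr_row map_col !mxE.
  by apply: eq_bigr => k _; rewrite !mxE.
rewrite dE; apply: Kp; apply/negP => /eqP Pi0.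
have := row_free_unit P; rewrite PU => freeP.
have /eqP : row i P = 0 by rewrite -[LHS]trmxCK Pi0 trmx0 map_mx0.
rewrite rowE mulmx_free_eq0 // => /eqP/matrixP/(_ 0 i).
by rewrite !mxE !eqxx => /eqP; rewrite oner_eq0.
Qed.

(** Both densities share the positive normalising constant, so only the exponents matter: zero when
    the mean is [z], negative otherwise. Strictness is what later makes the maximizer unique. *)
Lemma cn_pdf_mode {R : realType} {n} (mu z : 'cV[R[i]]_n) (K : 'M[R[i]]_n) :
  posdefmx K -> mu != z -> cn_pdf mu K z < cn_pdf z K z.
Proof.
move=> Kpd muz; rewrite /cn_pdf subrr mulmx0.
rewrite [X in _ < expR (- complex.Re X) / _]mxE.
have detK := det_posdefmx_gt0 _ Kpd.
have c0 : 0 < pi ^+ n * complex.Re (\det K).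
  rewrite mulr_gt0 ?exprn_gt0 ?pi_gt0 //.
  (* In [R[i]], [<] means equal imaginary parts and ordered real parts. *)
  by move: detK; rewrite ltcE => /andP[].
rewrite ltr_pM2r ?invr_gt0 // ltr_expR ltrN2.
have [_ /(_ (z - mu))] := posdefmx_inv _ Kpd.
by rewrite subr_eq0 eq_sym => /(_ muz); rewrite ltcE => /andP[].
Qed.

Lemma matched_estimator_observation {R : realType} {N M}
    (Psi_p Psi_u : 'M[R[i]]_(N, M)) (gamma : 'cV[R[i]]_M) :
  \rank Psi_p = M ->
  matched_estimator Psi_p (observation Psi_p Psi_u gamma 0) =
  gamma + invmx (Psi_p^t* *m Psi_p) *m (Psi_p^t* *m Psi_u *m gamma).
Proof.
move=> /posdefmx_gram /posdefmx_unit Ru.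
rewrite /matched_estimator matched_pilot_observation.
by rewrite mulmx0 addr0 mulmxDr mulKmx.
Qed.

(** The payload is fixed here; quantifying over admissible payloads gives the first claim. *)
Lemma matched_estimator_exactP {R : realType} {N M}
    {Psi_p Psi_u : 'M[R[i]]_(N, M)} :
  \rank Psi_p = M ->
  (forall gamma,
     matched_estimator Psi_p (observation Psi_p Psi_u gamma 0) = gamma) <->
  Psi_p^t* *m Psi_u = 0.
Proof.
move=> rk; split=> [est | R0 gamma]; last first.
  by rewrite matched_estimator_observation // R0 mul0mx mulmx0 addr0.
have Ru := posdefmx_unit _ (posdefmx_gram _ rk).
have cols (gamma : 'cV_M) : Psi_p^t* *m Psi_u *m gamma = 0.
  have /eqP := est gamma; rewrite matched_estimator_observation //.
  rewrite -subr_eq0 addrAC subrr add0r => /eqP E.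
  by rewrite -[LHS](mulKVmx Ru) E mulmx0.
(* Taking unit vectors for [gamma] reads off the columns of the interference matrix. *)
apply/matrixP => i j; have /colP/(_ i) := cols (delta_mx j 0).
by rewrite -colE [LHS]mxE => ->; rewrite !mxE.
Qed.

Lemma reduced_likelihood_maximizerP {R : realType} {N M} {sigma2 : R}
    {Psi_p Psi_u : 'M[R[i]]_(N, M)} (r : 'cV[R[i]]_N) (gamma : 'cV[R[i]]_M) :
  0 < sigma2 -> \rank Psi_p = M -> Psi_p^t* *m Psi_u = 0 ->
  is_maximizer (reduced_likelihood sigma2 Psi_p Psi_u (matched_pilot Psi_p r))
    gamma <-> gamma = matched_estimator Psi_p r.
Proof.
move=> sigma2_gt0 rk R0.
have Rpd := posdefmx_gram _ rk; have Ru := posdefmx_unit _ Rpd.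
set t := matched_pilot Psi_p r; set ghat := matched_estimator Psi_p r.
have likE y : reduced_likelihood sigma2 Psi_p Psi_u t y =
    cn_pdf (Psi_p^t* *m Psi_p *m y) (sigma2%:C *: (Psi_p^t* *m Psi_p)) t.
  by rewrite /reduced_likelihood R0 mul0mx addr0.
have tE : Psi_p^t* *m Psi_p *m ghat = t by rewrite mulKVmx.
(* This gives both directions: [ghat] is a maximizer, and no other point is one. *)
have lt_lik y : y != ghat ->
    reduced_likelihood sigma2 Psi_p Psi_u t y <
    reduced_likelihood sigma2 Psi_p Psi_u t ghat.
  move=> yg; rewrite !likE tE; apply: cn_pdf_mode.
    by apply: posdefmxZ => //; rewrite ltcR.
  (* The Gram matrix is invertible, so distinct coefficient vectors give distinct means. *)
  by rewrite -tE; apply: contraNneq yg => /(can_inj (mulKmx Ru)) ->.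
split=> [ml | -> y].
  by apply/eqP; apply: contraT => /lt_lik; rewrite ltNge ml.
by have [-> // | /lt_lik/ltW] := eqVneq y ghat.
Qed.

Theorem proposition1 (R : realType) (N L Q Np Nu : nat)
    (HN : (0 < N)%N) (HL : (0 < L)%N) (HQ : (0 < Q)%N)
    (HNp : (0 < Np)%N) (HNu : (0 < Nu)%N)
    (A : set R[i]) (s_p : 'cV[R[i]]_Np)
    (P_p : 'M[R[i]]_(Np + Nu, Np)) (P_u : 'M[R[i]]_(Np + Nu, Nu))
    (HPp : binary_mx P_p) (HPu : binary_mx P_u) (HPpu : P_p^T *m P_u = 0)
    (C : 'M[R[i]]_(N, Np + Nu)) (g : guard) (c1 : R)
    (Phi : 'M[R[i]]_(N, Q)) (D : 'M[R[i]]_N) (HD : D \is unitarymx)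
    (sigma2 : R) (Hsigma2 : 0 < sigma2) :
  let Psi_p : 'M[R[i]]_(N, L * Q) :=
    sensing_mx L g c1 Phi D (C *m P_p *m s_p) in
  let Psi_u (s_u : 'cV[R[i]]_Nu) : 'M[R[i]]_(N, L * Q) :=
    sensing_mx L g c1 Phi D (C *m P_u *m s_u) in
  \rank Psi_p = (L * Q)%N ->
  ((forall (s_u : 'cV[R[i]]_Nu) (gamma : 'cV[R[i]]_(L * Q)),
      admissible A s_u ->
      matched_estimator Psi_p (observation Psi_p (Psi_u s_u) gamma 0) = gamma)
   <-> zpdi A Psi_p Psi_u)
  /\
  (zpdi A Psi_p Psi_u ->
   forall (s_u : 'cV[R[i]]_Nu) (gamma : 'cV[R[i]]_(L * Q)) (w : 'cV[R[i]]_N),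
     admissible A s_u ->
     let r := observation Psi_p (Psi_u s_u) gamma w in
     forall gamma_ml : 'cV[R[i]]_(L * Q),
       is_maximizer
         (reduced_likelihood sigma2 Psi_p (Psi_u s_u) (matched_pilot Psi_p r))
         gamma_ml
       <-> gamma_ml = matched_estimator Psi_p r).
Proof.
move=> Psi_p Psi_u rk; split; [split=> [est s_u As | zp s_u gamma As] | ].
- by apply: (proj1 (matched_estimator_exactP rk)) => gamma; apply: est.
- exact: (proj2 (matched_estimator_exactP rk) (zp s_u As)).
- move=> zp s_u gamma w As r gamma_ml.
  exact: reduced_likelihood_maximizerP Hsigma2 rk (zp s_u As).
Qed.
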